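(* Let $\mathbb{K}$ be a field and let $\mathcal{S}\subsetneq\mathbb{N}$ be a numerical semigroup. The toric ideal $I_{\mathcal{S}}$ is robust if and only if $\mathcal{S}$ is $2$-generated, i.e. its minimal generating set has exactly two elements.
   Context: A numerical semigroup is a submonoid $\mathcal{S}$ of $(\mathbb{N},+)$ with finite complement; it has a unique minimal generating set $A=\{a_1,\ldots,a_m\}\subseteq\mathbb{Z}^+$, which is finite. The toric ideal $I_{\mathcal{S}}\subseteq\mathbb{K}[x_1,\ldots,x_m]$ is generated by all binomials $\mathbf{x}^{\mathbf{u}}-\mathbf{x}^{\mathbf{v}}$ with $\sum_i u_ia_i=\sum_i v_ia_i$. The universal Gröbner basis is the union of all reduced Gröbner bases of $I_{\mathcal{S}}$ over all monomial orders; binomials are considered up to sign. $I_{\mathcal{S}}$ is robust if its universal Gröbner basis is a minimal set of generators of the ideal. *)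

(* Defs.v *)
From mathcomp Require Import all_boot all_order all_algebra.
From mathcomp Require Export mpoly.

Set Implicit Arguments.
Unset Strict Implicit.
Unset Printing Implicit Defensive.

Import GRing.Theory.
Local Open Scope ring_scope.

Definition numerical_semigroup (S : {pred nat}) : Prop :=
  [/\ 0%N \in S,
      forall s t : nat, s \in S -> t \in S -> (s + t)%N \in S
    & exists gaps : seq nat, forall n : nat, n \notin S -> n \in gaps].

(* The submonoid generated by A is the set of finite sums, repetitions and
   the empty sum allowed, of elements of A. *)
Definition generates_semigroup (A S : {pred nat}) : Prop :=
  forall n : nat, n \in S <-> exists2 s : seq nat, {subset s <= A} & n = sumn s.

Definition minimal_generating_set (A S : {pred nat}) : Prop :=
  generates_semigroup A S /\
  forall B : {pred nat},
    {subset B <= A} -> generates_semigroup B S -> {subset A <= B}.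

Definition ideal_generated (R : comNzRingType) (G : R -> Prop) (f : R) : Prop :=
  exists2 s : seq (R * R),
    forall p, p \in s -> G p.2 & f = \sum_(p <- s) p.1 * p.2.

Definition minimal_ideal_generators (R : comNzRingType) (B I : R -> Prop) : Prop :=
  (forall f, I f <-> ideal_generated B f) /\
  forall C : R -> Prop,
    (forall f, C f -> B f) -> (forall f, I f <-> ideal_generated C f) ->
    forall f, B f -> C f.

Section Groebner.
Variables (m : nat) (K : fieldType).
Implicit Types (le : rel 'X_{1..m}) (I G : {mpoly K[m]} -> Prop).

Definition monomial_order le : Prop :=
  [/\ total le, antisymmetric le, transitive le,
      forall u, le 0%MM u
    & forall u v w, le u v -> le (u + w)%MM (v + w)%MM].

(* The zero polynomial has no leading exponent. *)
Definition leading_exponent le (f : {mpoly K[m]}) (u : 'X_{1..m}) : Prop :=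
  u \in msupp f /\ forall v, v \in msupp f -> le v u.

Definition initial_ideal le G : {mpoly K[m]} -> Prop :=
  ideal_generated
    (fun p => exists g u, [/\ G g, leading_exponent le g u & p = 'X_[u]]).

Definition groebner_basis le I (G : seq {mpoly K[m]}) : Prop :=
  (forall g, g \in G -> I g) /\
  forall f, initial_ideal le I f <-> initial_ideal le (fun g => g \in G) f.

Definition reduced_groebner_basis le I (G : seq {mpoly K[m]}) : Prop :=
  [/\ groebner_basis le I G,
      forall g, g \in G -> exists2 u, leading_exponent le g u & g@_u = 1
    & forall g, g \in G -> forall u, u \in msupp g ->
        ~ initial_ideal le (fun h => h \in G /\ h <> g) 'X_[u]].

Definition universal_groebner_basis I (f : {mpoly K[m]}) : Prop :=
  exists le (G : seq {mpoly K[m]}),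
    [/\ monomial_order le, reduced_groebner_basis le I G & f \in G].

(* An element of a reduced basis has leading coefficient 1, so a binomial and
   its opposite both occur in the union when its two terms can be ordered
   either way. B keeps exactly one element of each pair {f, -f}. *)
Definition representatives_up_to_sign (B U : {mpoly K[m]} -> Prop) : Prop :=
  [/\ forall f, B f -> U f,
      forall f, U f -> B f \/ B (- f)
    & forall f, B f -> B (- f) -> - f = f].

Definition robust I : Prop :=
  exists2 B, representatives_up_to_sign B (universal_groebner_basis I)
    & minimal_ideal_generators B I.

End Groebner.

Definition semigroup_degree (m : nat) (a : m.-tuple nat) (u : 'X_{1..m}) : nat :=
  (\sum_(i < m) u i * tnth a i)%N.

Definition toric_ideal (K : fieldType) (m : nat) (a : m.-tuple nat) :
    {mpoly K[m]} -> Prop :=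
  ideal_generated
    (fun f => exists u v : 'X_{1..m},
       semigroup_degree a u = semigroup_degree a v /\ f = 'X_[u] - 'X_[v]).
Arguments toric_ideal K {m} a.

(* Main.v *)
Require Import Defs.
From mathcomp Require Import all_boot all_order all_algebra.
From mathcomp Require Import zify ring.

Set Implicit Arguments.
Unset Strict Implicit.
Unset Printing Implicit Defensive.

Import GRing.Theory Order.TTheory.
Local Open Scope ring_scope.

(** The circuit of two variables x_i and x_j is the binomial x_j^p - x_i^q whose
    two monomials have degree lcm (a_i, a_j), in the grading where x_i has degree
    a_i.

    Suppose that the ideal is robust. Every circuit lies in the universal Groebner
    basis ([circuit_universal]): for the order that puts all other variables above
    x_j and x_j above x_i, its leading monomial x_j^p is a minimal generator of the
    initial ideal and its other monomial x_i^q is standard, so it belongs to the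
    reduced basis. This basis is finite without an appeal to Dickson's lemma: every
    variable x_k other than x_i has its power x_k^(a_i) in the initial ideal, and
    a minimal generator of the initial ideal shares no variable with its normal
    form, which together bound the degrees of the minimal generators
    ([minimal_nonstandard_degree]). Moreover all elements of the universal Groebner
    basis are homogeneous ([universal_homogeneous]).

    If there are three variables x_i, x_j, x_k, let the circuit of i and j be the
    one of largest degree. Its two monomials are divisible by the pure powers of x_j
    and x_i in the circuits of k with j and with i, so modulo these two circuits
    they become monomials divisible by x_k. The difference of the latter is x_k times
    a binomial of lower degree, which by homogeneity is a combination of generators
    other than the circuit of i and j. So this circuit is redundant, and a minimal
    generating set cannot contain all three ([not_robust_triangle]).

    With two variables the fibers of the degree are arithmetic progressions whose
    step is the circuit; hence the ideal is principal, generated by the circuit, and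
    each reduced Groebner basis consists of the circuit with the sign that makes it
    monic ([reduced_basis_two]).

    A proper numerical semigroup has at least two generators: a common divisor of
    the generators divides two consecutive numbers beyond the gaps, so it is 1, and
    a single generator would have to be 1. *)

(** * Ideals given by generators *)

Section GeneratedIdeals.
Variable R : comNzRingType.
Implicit Types (B C : R -> Prop) (f g p : R).

Lemma ideal_generated0 B : ideal_generated B 0.
Proof. by exists [::]; rewrite ?big_nil. Qed.

Lemma ideal_generated_gen B b : B b -> ideal_generated B b.
Proof.
move=> Bb; exists [:: (1, b)]; last by rewrite big_seq1 mul1r.
by move=> p; rewrite inE => /eqP->.
Qed.

Lemma ideal_generatedD B f g :
  ideal_generated B f -> ideal_generated B g -> ideal_generated B (f + g).
Proof.
move=> [s Bs ->] [t Bt ->]; exists (s ++ t); last by rewrite big_cat.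
by move=> p; rewrite mem_cat => /orP[/Bs|/Bt].
Qed.

Lemma ideal_generatedM B p f :
  ideal_generated B f -> ideal_generated B (p * f).
Proof.
move=> [s Bs ->]; exists [seq (p * x.1, x.2) | x <- s].
  by move=> _ /mapP[x /Bs ? ->].
by rewrite big_map mulr_sumr; apply: eq_bigr => x _; rewrite mulrA.
Qed.

Lemma ideal_generatedN B f : ideal_generated B f -> ideal_generated B (- f).
Proof. by move=> /(ideal_generatedM (-1)); rewrite mulN1r. Qed.

Lemma ideal_generatedB B f g :
  ideal_generated B f -> ideal_generated B g -> ideal_generated B (f - g).
Proof. by move=> Bf /ideal_generatedN; apply: ideal_generatedD. Qed.

Lemma ideal_generated_ind B (P : R -> Prop) :
    P 0 -> (forall f g, P f -> P g -> P (f + g)) ->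
    (forall p b, B b -> P (p * b)) ->
  forall f, ideal_generated B f -> P f.
Proof.
move=> P0 PD PM f [s Bs ->]; rewrite big_seq_cond.
by apply: big_ind => // x; rewrite andbT => /Bs; apply: PM.
Qed.

Lemma ideal_generated_trans B C :
    (forall b, B b -> ideal_generated C b) ->
  forall f, ideal_generated B f -> ideal_generated C f.
Proof.
move=> BC; apply: ideal_generated_ind => [|f g|p b /BC].
- exact: ideal_generated0.
- exact: ideal_generatedD.
- exact: ideal_generatedM.
Qed.

Lemma ideal_generated_sum B (I : eqType) (r : seq I) (F : I -> R) :
    (forall x, x \in r -> ideal_generated B (F x)) ->
  ideal_generated B (\sum_(x <- r) F x).
Proof.
move=> BF; rewrite big_seq_cond; apply: big_ind => [|f g|x].
- exact: ideal_generated0.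
- exact: ideal_generatedD.
- by rewrite andbT => /BF.
Qed.

(** Deleting a redundant element from a generating set leaves a generating set, which
    minimality forbids. *)
Lemma minimal_generator_irredundant B I f :
    minimal_ideal_generators B I -> B f ->
  ~ ideal_generated (fun g => B g /\ g <> f) f.
Proof.
move=> [genB minB] Bf If.
have [|h|_ []//] := minB (fun g => B g /\ g <> f) _ _ f Bf; first by move=> g [].
rewrite genB; split; apply: ideal_generated_trans => b.
  by move=> Bb; have [->//|/eqP nb] := eqVneq b f; apply: ideal_generated_gen.
by case=> Bb _; apply: ideal_generated_gen.
Qed.

End GeneratedIdeals.

(** * Initial ideals and reduced bases *)

Lemma total_min (T : eqType) (le : rel T) (s : seq T) :
    total le -> transitive le -> s != [::] ->
  exists2 x, x \in s & forall y, y \in s -> le x y.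
Proof.
move=> tot tr; elim: s => // x s IH _.
have [->|/IH[y ys ymin]] := eqVneq s [::].
  by exists x => [|y]; rewrite inE // => /eqP->; have := tot x x; rewrite orbb.
have [xy|yx] := orP (tot x y).
  exists x; first exact: mem_head.
  move=> z; rewrite inE => /orP[/eqP->|/ymin/(tr _ _ _ xy)//].
  by have := tot x x; rewrite orbb.
exists y => [|z]; first by rewrite inE ys orbT.
by rewrite inE => /orP[/eqP->|/ymin].
Qed.

Section InitialIdeals.
Variables (m : nat) (K : fieldType).
Implicit Types (f g p : {mpoly K[m]}) (u v w : 'X_{1..m}).

Lemma msupp_mulXP p w u :
  u \in msupp (p * 'X_[w]) -> exists2 v, v \in msupp p & u = (w + v)%MM.
Proof. by rewrite (perm_mem (msuppMX _ _)) => /mapP. Qed.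

(** Membership in a monomial ideal is decided monomial by monomial, by divisibility
    by one of the generators. *)
Lemma initial_idealP (le : rel 'X_{1..m}) G f :
  initial_ideal le G f <->
  forall w, w \in msupp f ->
    exists g u, [/\ G g, leading_exponent le g u & (u <= w)%MM].
Proof.
split=> [|divf].
  move: f; apply: ideal_generated_ind => [|f g Pf Pg w|p _ [g [u [Gg lu ->]]] w].
  - by move=> w; rewrite msupp0.
  - by move/msuppD_le; rewrite mem_cat => /orP[/Pf|/Pg].
  - case/msupp_mulXP=> v _ ->; exists g, u; split=> //; exact: lem_addr.
rewrite /initial_ideal [f]mpolyE; apply: ideal_generated_sum => w.
case/divf=> g [u [Gg lu uw]]; rewrite -(submK uw) mpolyXD scalerAl.
by apply/ideal_generatedM/ideal_generated_gen; exists g, u.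
Qed.

Lemma initial_idealX (le : rel 'X_{1..m}) G w :
  initial_ideal le G 'X_[w] <->
  exists g u, [/\ G g, leading_exponent le g u & (u <= w)%MM].
Proof.
rewrite initial_idealP; split=> [|H v]; first by apply; rewrite msuppX inE.
by rewrite msuppX inE => /eqP->.
Qed.

Section Order.
Variable le : rel 'X_{1..m}.
Hypothesis le_mo : monomial_order le.

Lemma monomial_order_refl u : le u u.
Proof. by case: le_mo => tot _ _ _ _; have := tot u u; rewrite orbb. Qed.

Lemma monomial_order_lepm u v : (u <= v)%MM -> le u v.
Proof.
case: le_mo => _ _ _ le0 leD /submK <-.
by rewrite -{1}[u]add0m; apply: leD.
Qed.

Lemma leading_exponent_exists f :
  f != 0 -> exists u, leading_exponent le f u.
Proof.
case: le_mo => tot _ tr _ _; rewrite -msupp_eq0.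
case/(@total_min _ (fun x y => le y x)) => [x y|y x z xy yz|u uf umax].
- exact: tot.
- exact: tr yz xy.
- by exists u.
Qed.

(** A tail monomial of a reduced basis element is not a multiple of the leading
    monomial of the same element either, since a proper multiple is larger. *)
Lemma reduced_tail_standard I G g u w :
    reduced_groebner_basis le I G -> g \in G -> leading_exponent le g u ->
    w \in msupp g -> w != u -> ~ initial_ideal le I 'X_[w].
Proof.
move=> [[_ inI] _ red] gG [ug umax] wg wu; rewrite inI => /initial_idealX.
case=> h [v [hG [vh vmax] vw]]; have [hg|/eqP hg] := eqVneq h g; last first.
  by apply: (red g gG w wg); apply/initial_idealX; exists h, v.
case: le_mo => _ anti tr _ _; move: vh vmax; rewrite hg => vg vmax.
have uw := tr _ _ _ (vmax u ug) (monomial_order_lepm vw).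
by move/eqP: wu; apply; apply: anti; rewrite umax.
Qed.

(** The initial ideal is also generated by the leading monomials of the reduced basis,
    none of which divides another; so each of them is minimal for divisibility. *)
Lemma reduced_head_minimal I G g u v :
    reduced_groebner_basis le I G -> g \in G -> leading_exponent le g u ->
    initial_ideal le I 'X_[v] -> (v <= u)%MM -> v = u.
Proof.
move=> [[_ inI] _ red] gG [ug umax]; rewrite inI => /initial_idealX.
case=> h [t [hG [th tmax] tv]] vu; have tu := lepm_trans tv vu.
have [hg|/eqP hg] := eqVneq h g; last first.
  by case: (red g gG u ug); apply/initial_idealX; exists h, t; split.
case: le_mo => _ anti tr _ _; move: th tmax; rewrite hg => tg tmax.
apply: anti; rewrite (monomial_order_lepm vu) (tr t) ?tmax //.
exact: monomial_order_lepm.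
Qed.

(** Every nonzero element of an ideal has a monomial in the initial ideal,
    namely its leading one. *)
Lemma standard_support_eq0 (I : {mpoly K[m]} -> Prop) f :
    I f -> (forall w, w \in msupp f -> ~ initial_ideal le I 'X_[w]) -> f = 0.
Proof.
move=> If std; apply/eqP/negP => /negP/leading_exponent_exists[u lu].
case: (std u lu.1); apply/initial_idealX; exists f, u; split=> //.
exact: lepm_refl.
Qed.

End Order.
End InitialIdeals.

(** * The grading of a toric ideal *)

Section ToricIdeals.
Variables (K : fieldType) (m : nat) (a : m.-tuple nat).
Implicit Types (f g h p b : {mpoly K[m]}) (u v w : 'X_{1..m}).

Lemma semigroup_degreeD u v :
  semigroup_degree a (u + v)%MM = (semigroup_degree a u + semigroup_degree a v)%N.
Proof.
by rewrite /semigroup_degree -big_split; apply: eq_bigr => i _; rewrite mnmDE mulnDl.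
Qed.

Lemma semigroup_degree_Mn i n :
  semigroup_degree a (U_(i) *+ n)%MM = (n * tnth a i)%N.
Proof.
rewrite /semigroup_degree (bigD1 i) //= big1 => [|j ji].
  by rewrite mulmnE mnm1E eqxx mul1n addn0.
by rewrite mulmnE mnm1E eq_sym (negbTE ji).
Qed.

(** The grading of the polynomial ring in which x_i has degree a_i. *)
Definition homogeneous d f := forall u, u \in msupp f -> semigroup_degree a u = d.

Definition component d f : {mpoly K[m]} :=
  \sum_(u <- msupp f | semigroup_degree a u == d) f@_u *: 'X_[u].

Lemma mcoeff_component d f u :
  (component d f)@_u = if semigroup_degree a u == d then f@_u else 0.
Proof.
rewrite /component raddf_sum /= [f in RHS]mpolyE raddf_sum /=.
case: eqP => [ud|ud]; last first.
  rewrite big1 // => v /eqP vd; rewrite mcoeffZ mcoeffX.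
  by case: eqVneq => [vu|]; [case: ud; rewrite -vu | rewrite mulr0].
rewrite big_mkcond; apply: eq_bigr => v _; rewrite mcoeffZ mcoeffX.
by case: (eqVneq v u) => [->|]; rewrite ?ud ?eqxx ?mulr0 ?if_same.
Qed.

Lemma componentD d : {morph component d : f g / f + g}.
Proof.
move=> f g; apply/mpolyP => u; rewrite mcoeffD !mcoeff_component mcoeffD.
by case: ifP; rewrite ?addr0.
Qed.

Lemma component0 d : component d 0 = 0.
Proof. by rewrite /component msupp0 big_nil. Qed.

Lemma component_homogeneous d e f :
  homogeneous d f -> component e f = if d == e then f else 0.
Proof.
move=> fd; apply/mpolyP => u; rewrite mcoeff_component.
have [/fd->|] := boolP (u \in msupp f); first by case: ifP; rewrite ?mcoeff0.
by rewrite -mcoeff_eq0 => /eqP u0; case: ifP; case: ifP; rewrite ?mcoeff0 ?u0.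
Qed.

Lemma homogeneous_binomial u v :
  semigroup_degree a u = semigroup_degree a v ->
  homogeneous (semigroup_degree a u) ('X_[u] - 'X_[v]).
Proof.
by move=> uv w /msuppB_le; rewrite mem_cat !msuppX !inE => /orP[]/eqP->.
Qed.

(** In a homogeneously generated ideal the component of degree [e] of an element
    uses only generators of degree at most [e]: in a combination of generators,
    the others contribute monomials of degree larger than [e]. *)
Lemma component_ideal_generated B e h :
    (forall b, B b -> exists c, homogeneous c b) -> ideal_generated B h ->
  ideal_generated (fun b => B b /\ exists2 c, (c <= e)%N & homogeneous c b)
    (component e h).
Proof.
move=> homB; move: h; apply: ideal_generated_ind => [|f g|p b Bb].
- by rewrite component0; apply: ideal_generated0.
- by rewrite componentD; apply: ideal_generatedD.
have [c bc] := homB b Bb.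
rewrite [p]mpolyE mulr_suml (big_morph _ (componentD e) (component0 e)).
apply: ideal_generated_sum => w _; rewrite -scalerAl.
have wb : homogeneous (semigroup_degree a w + c) (p@_w *: ('X_[w] * b)).
  move=> u /msuppZ_le; rewrite mulrC => /msupp_mulXP[v /bc <- ->].
  exact: semigroup_degreeD.
rewrite (component_homogeneous _ wb); case: eqP => [<-|_]; last first.
  exact: ideal_generated0.
rewrite scalerAl; apply/ideal_generatedM/ideal_generated_gen.
by split=> //; exists c; rewrite ?leq_addl.
Qed.

Lemma toric_ideal_binomial u v :
  semigroup_degree a u = semigroup_degree a v ->
  toric_ideal K a ('X_[u] - 'X_[v]).
Proof. by move=> uv; apply: ideal_generated_gen; exists u, v. Qed.

Lemma component_toric_ideal d f :
  toric_ideal K a f -> toric_ideal K a (component d f).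
Proof.
move/(component_ideal_generated d) => H.
apply: ideal_generated_trans (H _) => [b [Bb _]|_ [u [v [uv ->]]]].
  exact: ideal_generated_gen.
by exists (semigroup_degree a u); apply: homogeneous_binomial.
Qed.

(** A homogeneous component of [f] that is a single term [c x^u] lies in the
    ideal, hence vanishes at the point (1, ..., 1), so that [c = 0]. *)
Lemma toric_ideal_msupp f u :
    toric_ideal K a f -> u \in msupp f ->
  exists v, [/\ v \in msupp f, v != u
              & semigroup_degree a v = semigroup_degree a u].
Proof.
move=> If uf; case: (pickP (fun v : seq_sub (msupp f) => (ssval v != u) &&
    (semigroup_degree a (ssval v) == semigroup_degree a u)))
  => [v /andP[vu /eqP]|alone].
  by exists (ssval v); split=> //; apply: ssvalP.
have eval1 g : toric_ideal K a g -> g.@[fun=> 1] = 0.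
  have evalX w : 'X_[w].@[fun=> 1] = 1 :> K.
    by rewrite mevalX big1 // => i _; rewrite expr1n.
  move: g; apply: ideal_generated_ind => [|g h g0 h0|p _ [v [w [_ ->]]]].
  - exact: raddf0.
  - by rewrite mevalD g0 h0 addr0.
  - by rewrite mevalM mevalB !evalX subrr mulr0.
have := eval1 _ (component_toric_ideal (semigroup_degree a u) If).
suff -> : component (semigroup_degree a u) f = f@_u *: 'X_[u].
  rewrite mevalZ mevalX big1 => [|i _]; last by rewrite expr1n.
  by rewrite mulr1 => /eqP; rewrite mcoeff_eq0 uf.
apply/mpolyP => v; rewrite mcoeff_component mcoeffZ mcoeffX.
have [->|uv] := eqVneq u v; first by rewrite eqxx mulr1.
rewrite mulr0; case: ifP => // vd; apply/eqP; rewrite mcoeff_eq0.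
by apply/negP => vf; have := alone (SeqSub vf); rewrite /= eq_sym uv vd.
Qed.

End ToricIdeals.

(** * Standard monomials and a finite reduced basis *)

Section StandardMonomials.
Variables (K : fieldType) (m : nat) (a : m.-tuple nat) (le : rel 'X_{1..m}).
Hypothesis a_gt0 : forall i, (0 < tnth a i)%N.
Hypothesis le_mo : monomial_order le.
Implicit Types (f g h : {mpoly K[m]}) (u v w : 'X_{1..m}).

Local Notation deg := (semigroup_degree a).
Local Notation I := (toric_ideal K a).

Lemma mdeg_le_semigroup_degree u : (mdeg u <= deg u)%N.
Proof. by rewrite mdegE; apply: leq_sum => i _; rewrite leq_pmulr. Qed.

(** As the a_i are positive, the total degree of a monomial is at most its degree in
    the grading; this makes the fiber a finite list. *)
Definition fiber u : seq 'X_{1..m} :=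
  [seq v <- [seq bmnm v | v : 'X_{1..m < (deg u).+1}] | deg v == deg u].

Lemma mem_fiber u v : (v \in fiber u) = (deg v == deg u).
Proof.
rewrite mem_filter andb_idr // => /eqP uv; apply/mapP.
have vu : (mdeg v < (deg u).+1)%N by rewrite ltnS -uv mdeg_le_semigroup_degree.
by exists (BMultinom vu); rewrite ?mem_enum.
Qed.

(** The list always has exactly one element, the minimum of the fiber, so that the
    default value is never used. *)
Definition normal_form u : 'X_{1..m} :=
  head u [seq v <- fiber u | all (le v) (fiber u)].

Lemma normal_formP u :
  deg (normal_form u) = deg u /\ forall v, deg v = deg u -> le (normal_form u) v.
Proof.
have : normal_form u \in [seq v <- fiber u | all (le v) (fiber u)].
  have [|||x xu xmin] := @total_min _ le (fiber u); [by case: le_mo..| |].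
    by apply/eqP => u0; have := mem_fiber u u; rewrite u0 eqxx.
  have : x \in [seq v <- fiber u | all (le v) (fiber u)].
    by rewrite mem_filter xu andbT; apply/allP.
  by rewrite /normal_form; case: [seq _ <- _ | _] => // y s _; apply: mem_head.
rewrite mem_filter mem_fiber => /andP[/allP umin /eqP du]; split=> // v vu.
by apply: umin; rewrite mem_fiber vu.
Qed.

Lemma normal_form_degree u : deg (normal_form u) = deg u.
Proof. by case: (normal_formP u). Qed.

Lemma normal_form_le u v : deg v = deg u -> le (normal_form u) v.
Proof. by case: (normal_formP u) => _; apply. Qed.

Lemma normal_form_unique u v :
  deg v = deg u -> (forall w, deg w = deg u -> le v w) -> normal_form u = v.
Proof.
case: le_mo => _ anti _ _ _ vu vmin; apply: anti.
by rewrite normal_form_le // vmin // normal_form_degree.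
Qed.

Lemma normal_form_eq u v : deg u = deg v -> normal_form u = normal_form v.
Proof.
move=> uv; apply: normal_form_unique => [|w wu].
  by rewrite normal_form_degree.
by apply: normal_form_le; rewrite wu.
Qed.

Lemma normal_form_idem u : normal_form (normal_form u) = normal_form u.
Proof. by apply: normal_form_eq; rewrite normal_form_degree. Qed.

Definition standard u := normal_form u == u.

Lemma nonstandard_intro u v : deg v = deg u -> v != u -> le v u -> ~~ standard u.
Proof.
move=> vu nvu lvu; apply: contra nvu => /eqP su; apply/eqP.
case: le_mo => _ anti _ _ _; apply: anti.
by rewrite lvu -{1}su normal_form_le.
Qed.

Lemma leading_exponent_binomial u v :
  u != v -> le v u -> leading_exponent le ('X_[u] - 'X_[v] : {mpoly K[m]}) u.
Proof.
move=> uv vu; split.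
  rewrite mcoeff_msupp mcoeffB !mcoeffX eqxx (eq_sym v) (negbTE uv) subr0.
  exact: oner_neq0.
move=> w /msuppB_le; rewrite mem_cat !msuppX !inE => /orP[]/eqP-> //.
exact: monomial_order_refl.
Qed.

(** An element of the ideal has, along with its leading monomial, another monomial in
    the same fiber, and this one is smaller. *)
Lemma toric_initial_idealX w : initial_ideal le I 'X_[w] <-> ~~ standard w.
Proof.
split=> [/initial_idealX[g [u [Ig [ug umax] uw]]]|nw]; last first.
  apply/initial_idealX; exists ('X_[w] - 'X_[normal_form w]), w; split.
  - by apply: toric_ideal_binomial; rewrite normal_form_degree.
  - by apply: leading_exponent_binomial; rewrite 1?eq_sym // normal_form_le.
  - exact: lepm_refl.
have [v [vg vu dvu]] := toric_ideal_msupp Ig ug.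
rewrite -(submK uw) addmC; apply: (@nonstandard_intro _ (v + (w - u))%MM).
- by rewrite !semigroup_degreeD dvu.
- by rewrite eqm_add2r.
- by case: le_mo => _ _ _ _ leD; apply: leD; apply: umax.
Qed.

Lemma nonstandard_lepm u w : ~~ standard u -> (u <= w)%MM -> ~~ standard w.
Proof.
move=> /toric_initial_idealX/initial_idealX[g [t [Ig lt tu]]] uw.
apply/toric_initial_idealX/initial_idealX; exists g, t; split=> //.
exact: lepm_trans uw.
Qed.

(** The minimal generators of the initial ideal. *)
Definition minimal_nonstandard u :=
  ~~ standard u && [forall k, (0 < u k)%N ==> standard (u - U_(k))%MM].

Lemma mnm1_lepm u k : (0 < u k)%N -> (U_(k) <= u)%MM.
Proof. by rewrite lep1mP lt0n. Qed.

Lemma minimal_nonstandard_le u t :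
  minimal_nonstandard u -> ~~ standard t -> (t <= u)%MM -> t = u.
Proof.
move=> /andP[_ /forallP umin] nt tu.
apply/mnmP => k; apply/eqP; rewrite eqn_leq (mnm_lepP tu k) leqNgt /=.
apply/negP => tk; have := umin k; rewrite (leq_ltn_trans _ tk) //=.
apply/negP; apply: nonstandard_lepm nt _; apply/mnm_lepP => l.
rewrite mnmBE mnm1E; have := mnm_lepP tu l.
by case: eqVneq tk => [->|_ _]; lia.
Qed.

Lemma minimal_nonstandard_divisor w :
  ~~ standard w -> exists2 u, minimal_nonstandard u & (u <= w)%MM.
Proof.
have [n] := ubnP (mdeg w); elim: n w => // n IH w wn nw.
have [wmin|] := boolP [forall k, (0 < w k)%N ==> standard (w - U_(k))%MM].
  by exists w; [rewrite /minimal_nonstandard nw|exact: lepm_refl].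
rewrite negb_forall => /existsP[k]; rewrite negb_imply => /andP[wk nwk].
have [|u umin uw] := IH _ _ nwk; last first.
  by exists u => //; apply: lepm_trans uw (lem_subr _ _).
have := congr1 mdeg (submK (mnm1_lepm wk)); rewrite mdegD mdeg1; lia.
Qed.

(** A common variable of [u] and of its normal form could be cancelled, leaving a
    nonstandard proper divisor of [u]. *)
Lemma normal_form_disjoint u k :
  minimal_nonstandard u -> (0 < u k)%N -> normal_form u k = 0%N.
Proof.
move=> /andP[nu /forallP/(_ k)/implyP umin] uk; have := umin uk.
case: (posnP (normal_form u k)) => // rk su.
have uE := submK (mnm1_lepm uk); have rE := submK (mnm1_lepm rk).
have [_ _ tr _ leD] := le_mo.
case/negP: nu; rewrite /standard -{2}uE -(eqP su); apply/eqP/normal_form_unique.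
  by rewrite semigroup_degreeD normal_form_degree -semigroup_degreeD uE.
move=> w wu; apply: (tr (normal_form u)); last exact: normal_form_le.
rewrite -rE; apply/leD/normal_form_le.
have := normal_form_degree u.
by rewrite -{1}rE -{2}uE !semigroup_degreeD => /addIn.
Qed.

Section FiniteBasis.
(** Having powers of all other variables in the initial ideal bounds every exponent
    of a standard monomial except that of x_i. *)
Variable i : 'I_m.
Hypothesis i_least : forall k, k != i -> ~~ standard (U_(k) *+ tnth a i)%MM.

Let bound := (\sum_(k < m) tnth a i * tnth a k)%N.

(** The bound holds for [u] itself if x_i does not divide [u], as the other exponents
    of a minimal generator are at most a_i. Otherwise x_i does not divide the normal
    form of [u], which has the same degree and whose other exponents are below a_i. *)
Lemma minimal_nonstandard_degree u : minimal_nonstandard u -> (deg u <= bound)%N.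
Proof.
have lepm_pow k n v : (n <= v k)%N -> (U_(k) *+ n <= v)%MM.
  move=> nv; apply/mnm_lepP => l; rewrite mulmnE mnm1E.
  by case: eqVneq => [<-|]; lia.
move=> umin; have /andP[nu /forallP su] := umin.
have [ui0|ui] := posnP (u i).
  apply: leq_sum => k _; rewrite leq_mul2r; apply/orP; right.
  have [->|ki] := eqVneq k i; first by rewrite ui0.
  rewrite leqNgt; apply/negP => uk.
  have := su k; rewrite (leq_ltn_trans _ uk) //=; apply/negP.
  apply: nonstandard_lepm (i_least ki) _; apply: lepm_pow.
  by rewrite mnmBE mnm1E eqxx; lia.
rewrite -normal_form_degree.
apply: leq_sum => k _; rewrite leq_mul2r; apply/orP; right.
have [->|ki] := eqVneq k i; first by rewrite normal_form_disjoint.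
rewrite leqNgt; apply/negP => /ltnW/lepm_pow rk.
have := nonstandard_lepm (i_least ki) rk.
by rewrite /standard normal_form_idem eqxx.
Qed.

Definition toric_basis : seq {mpoly K[m]} :=
  [seq 'X_[u] - 'X_[normal_form u] |
    u <- [seq bmnm u | u : 'X_{1..m < bound.+1}] & minimal_nonstandard u].

Lemma mem_toric_basis g :
  g \in toric_basis <->
  exists2 u, minimal_nonstandard u & g = 'X_[u] - 'X_[normal_form u].
Proof.
split=> [/mapP[u]|[u umin ->]].
  by rewrite mem_filter => /andP[umin _] ->; exists u.
apply: map_f; rewrite mem_filter umin; apply/mapP.
have ub : (mdeg u < bound.+1)%N.
  rewrite ltnS (leq_trans (mdeg_le_semigroup_degree u)) //.
  exact: minimal_nonstandard_degree.
by exists (BMultinom ub); rewrite ?mem_enum.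
Qed.

Lemma leading_exponent_unique f u v :
  leading_exponent le f u -> leading_exponent le f v -> u = v.
Proof.
move=> [uf umax] [vf vmax]; case: le_mo => _ anti _ _ _; apply: anti.
by rewrite vmax // umax.
Qed.

Lemma leading_exponent_minimal u :
  minimal_nonstandard u ->
  leading_exponent le ('X_[u] - 'X_[normal_form u] : {mpoly K[m]}) u.
Proof.
case/andP=> nu _; apply: leading_exponent_binomial; first by rewrite eq_sym.
exact: normal_form_le.
Qed.

(** The leading monomials of this basis do not divide each other, by minimality, nor
    the trailing monomials, which are standard. *)
Lemma toric_basis_reduced : reduced_groebner_basis le I toric_basis.
Proof.
have basisI g : g \in toric_basis -> I g.
  move=> /mem_toric_basis[u _ ->]; apply: toric_ideal_binomial.
  by rewrite normal_form_degree.
split=> [||g gG w].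
- split=> // f; rewrite !initial_idealP; split=> H w wf; last first.
    by have [g [u [gG lg uw]]] := H w wf; exists g, u; split=> //; apply: basisI.
  have /initial_idealX/toric_initial_idealX := H w wf.
  case/minimal_nonstandard_divisor=> u umin uw.
  exists ('X_[u] - 'X_[normal_form u]), u; split=> //.
    by apply/mem_toric_basis; exists u.
  exact: leading_exponent_minimal.
- move=> _ /mem_toric_basis[u umin ->].
  exists u; first exact: leading_exponent_minimal.
  have /andP[nu _] := umin.
  by rewrite mcoeffB !mcoeffX eqxx -/(standard u) (negbTE nu) subr0.
have [u umin gE] := (mem_toric_basis g).1 gG.
move=> wg /initial_idealX[h [t [[hG hg] lt tw]]].
have [t' tmin hE] := (mem_toric_basis h).1 hG.
have lt' := leading_exponent_minimal tmin; rewrite -hE in lt'.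
have Et := leading_exponent_unique lt lt'; rewrite -{t' lt'}Et in tmin hE.
have /andP[nt _] := tmin; move: wg; rewrite gE => /msuppB_le.
rewrite mem_cat !msuppX !inE => /orP[]/eqP Ew; move: tw; rewrite Ew => tu.
  by apply: hg; rewrite hE gE (minimal_nonstandard_le umin nt tu).
by have := nonstandard_lepm nt tu; rewrite /standard normal_form_idem eqxx.
Qed.

Lemma universal_minimal_nonstandard u :
  minimal_nonstandard u ->
  universal_groebner_basis I ('X_[u] - 'X_[normal_form u]).
Proof.
move=> umin; exists le, toric_basis; split=> //; first exact: toric_basis_reduced.
by apply/mem_toric_basis; exists u.
Qed.

End FiniteBasis.
End StandardMonomials.

(** * Elimination orders *)

Section WeightOrders.
Variable m : nat.
Implicit Types (u v w : 'X_{1..m}) (wt : 'X_{1..m} -> nat).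

Definition refine_order wt (le : rel 'X_{1..m}) : rel 'X_{1..m} :=
  fun u v => (wt u < wt v)%N || (wt u == wt v) && le u v.

Lemma refine_monomial_order wt le :
    (forall u v, wt (u + v)%MM = (wt u + wt v)%N) ->
  monomial_order le -> monomial_order (refine_order wt le).
Proof.
move=> wtD [tot anti tr le0 leD]; split=> [u v|u v|v u w|u|u v w].
- by rewrite /refine_order; case: ltngtP => //= _; apply: tot.
- rewrite /refine_order; case: ltngtP => //= _ /anti; exact.
- rewrite /refine_order => /orP[uv|/andP[/eqP-> uv]] /orP[vw|/andP[/eqP<- vw]].
  + by rewrite (ltn_trans uv vw).
  + by rewrite uv.
  + by rewrite vw.
  + by rewrite eqxx (tr _ _ _ uv vw) orbT.
- (* additivity forces the weight of the unit monomial to be zero *)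
  have := wtD 0%MM 0%MM; rewrite /refine_order addm0 le0 andbT orbC -leq_eqVlt; lia.
- rewrite /refine_order !wtD ltn_add2r eqn_add2r.
  by case: ltngtP => //= _; apply: leD.
Qed.

Lemma mnmc_monomial_order : monomial_order (fun u v => (u <= v)%O).
Proof.
split=> [||||u v w]; first exact: le_total.
- exact: le_anti.
- exact: le_trans.
- exact: le0m.
- by rewrite lemc_add2l.
Qed.

Definition elimination_weight (i j : 'I_m) u : nat :=
  \sum_(k | (k != i) && (k != j)) u k.

(** All other variables are above x_j, which is above x_i. *)
Definition elimination_order (i j : 'I_m) : rel 'X_{1..m} :=
  refine_order (elimination_weight i j)
    (refine_order (fun u => u j) (fun u v => (u <= v)%O)).

Lemma elimination_monomial_order i j : monomial_order (elimination_order i j).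
Proof.
apply: refine_monomial_order => [u v|].
  by rewrite -big_split; apply: eq_bigr => k _; rewrite mnmDE.
apply: refine_monomial_order mnmc_monomial_order => u v; exact: mnmDE.
Qed.

Lemma mulmn_same (i : 'I_m) n : (U_(i) *+ n)%MM i = n.
Proof. by rewrite mulmnE mnm1E eqxx mul1n. Qed.

Lemma mulmn_neq (i j : 'I_m) n : i != j -> (U_(i) *+ n)%MM j = 0%N.
Proof. by move=> ij; rewrite mulmnE mnm1E (negbTE ij). Qed.

Lemma elimination_weight_fst i j n : elimination_weight i j (U_(i) *+ n)%MM = 0%N.
Proof. by apply: big1 => k /andP[ki _]; rewrite mulmn_neq // eq_sym. Qed.

Lemma elimination_weight_snd i j n : elimination_weight i j (U_(j) *+ n)%MM = 0%N.
Proof. by apply: big1 => k /andP[_ kj]; rewrite mulmn_neq // eq_sym. Qed.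

Lemma elimination_weight_other i j k n :
  k != i -> k != j -> elimination_weight i j (U_(k) *+ n)%MM = n.
Proof.
move=> ki kj; rewrite /elimination_weight (bigD1 k) /= ?ki // mulmn_same.
by rewrite big1 ?addn0 // => l /andP[_ lk]; rewrite mulmn_neq // eq_sym.
Qed.

Lemma elimination_order_pure i j u :
  elimination_weight i j u = 0%N -> i != j ->
  u = (U_(i) *+ u i + U_(j) *+ u j)%MM.
Proof.
move=> /eqP; rewrite sum_nat_eq0 => /forallP u0 ij; apply/mnmP => k.
rewrite mnmDE; have [->|ki] := eqVneq k i.
  by rewrite mulmn_same mulmn_neq ?addn0 // eq_sym.
have [->|kj] := eqVneq k j; first by rewrite mulmn_same mulmn_neq.
have := u0 k; rewrite ki kj => /eqP->.
by rewrite !mulmn_neq // eq_sym.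
Qed.

Lemma elimination_order_le i j u v :
    elimination_order i j u v -> elimination_weight i j v = 0%N ->
  elimination_weight i j u = 0%N /\ (u j <= v j)%N.
Proof.
rewrite /elimination_order /refine_order => + v0; rewrite v0 ltn0 /=.
move=> /andP[/eqP-> H].
by split=> //; case: ltngtP H.
Qed.

End WeightOrders.

(** * Circuits belong to the universal Groebner basis *)

Section Circuits.
Variables (K : fieldType) (m : nat) (a : m.-tuple nat).
Hypothesis a_gt0 : forall i, (0 < tnth a i)%N.
Implicit Types (f g h : {mpoly K[m]}) (u v w : 'X_{1..m}) (i j k : 'I_m).

Local Notation deg := (semigroup_degree a).
Local Notation I := (toric_ideal K a).

(** The power of x_j whose degree is the least common multiple of a_i and a_j. *)
Definition circuit_power i j : 'X_{1..m} :=
  (U_(j) *+ (tnth a i %/ gcdn (tnth a i) (tnth a j)))%MM.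

Definition circuit i j : {mpoly K[m]} :=
  'X_[circuit_power i j] - 'X_[circuit_power j i].

Lemma circuitN i j : - circuit i j = circuit j i.
Proof. by rewrite /circuit opprB. Qed.

Lemma circuit_power_same i j :
  circuit_power i j j = (tnth a i %/ gcdn (tnth a i) (tnth a j))%N.
Proof. exact: mulmn_same. Qed.

Lemma circuit_power_off i j k : k != j -> circuit_power i j k = 0%N.
Proof. by move=> kj; rewrite /circuit_power mulmn_neq // eq_sym. Qed.

Lemma circuit_power_degree i j :
  deg (circuit_power i j) = lcmn (tnth a i) (tnth a j).
Proof. by rewrite semigroup_degree_Mn divn_mulAC ?dvdn_gcdl. Qed.

Lemma circuit_power_degreeC i j : deg (circuit_power j i) = deg (circuit_power i j).
Proof. by rewrite !circuit_power_degree lcmnC. Qed.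

Lemma circuit_exponent_gt0 i j : (0 < circuit_power i j j)%N.
Proof.
rewrite /circuit_power mulmn_same divn_gt0 ?gcdn_gt0 ?a_gt0 //.
exact: dvdn_leq (a_gt0 i) (dvdn_gcdl _ _).
Qed.

Lemma circuit_in_toric i j : I (circuit i j).
Proof. by apply: toric_ideal_binomial; rewrite circuit_power_degreeC. Qed.

Section EliminationOrder.
Variables (i j : 'I_m).
Hypothesis ij : i != j.
Local Notation le := (elimination_order i j).
Let le_mo : monomial_order le := elimination_monomial_order i j.

(** The binomial x_k^(a_i) - x_i^(a_k) lies in the ideal and is led by x_k. *)
Lemma elimination_least k : k != i -> ~~ standard a le (U_(k) *+ tnth a i)%MM.
Proof.
move=> ki; apply: (nonstandard_intro a_gt0 le_mo (v := (U_(i) *+ tnth a k)%MM)).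
- by rewrite !semigroup_degree_Mn mulnC.
- apply/eqP => /mnmP/(_ i); rewrite mulmn_same mulmn_neq // => ak.
  by have := a_gt0 k; rewrite ak.
rewrite /elimination_order /refine_order elimination_weight_fst.
have [->|kj] := eqVneq k j; last by rewrite elimination_weight_other // a_gt0.
by rewrite elimination_weight_snd mulmn_same mulmn_neq // a_gt0.
Qed.

Lemma standard_intro u :
  (forall v, deg v = deg u -> le v u -> v = u) -> standard a le u.
Proof.
move=> umin; apply/eqP/umin; first exact: normal_form_degree.
exact: normal_form_le.
Qed.

Lemma standard_power_i n : standard a le (U_(i) *+ n)%MM.
Proof.
apply: standard_intro => v dv /elimination_order_le.
rewrite elimination_weight_fst mulmn_neq // => -[//|v0 vj].
move: dv; rewrite (elimination_order_pure v0 ij) semigroup_degreeD.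
move: vj; rewrite leqn0 => /eqP->; rewrite addm0 !semigroup_degree_Mn addn0.
by move/eqP; rewrite eqn_pmul2r // => /eqP->.
Qed.

(** In the plane of the exponents of x_i and x_j, the monomials of the degree of
    x_j^n are spaced by multiples of the exponent of the circuit. *)
Lemma standard_power_j n :
  (n < circuit_power i j j)%N -> standard a le (U_(j) *+ n)%MM.
Proof.
rewrite mulmn_same => nlt; apply: standard_intro => v dv /elimination_order_le.
rewrite elimination_weight_snd mulmn_same => -[//|v0 vj].
move: dv; rewrite [in deg v](elimination_order_pure v0 ij) semigroup_degreeD.
rewrite !semigroup_degree_Mn => dv.
have g0 : (0 < gcdn (tnth a i) (tnth a j))%N by rewrite gcdn_gt0 a_gt0.
have /eqP nv : (n - v j == 0)%N.
  rewrite -leqn0 leqNgt; apply/negP => pos.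
  have : (tnth a i %/ gcdn (tnth a i) (tnth a j) %| n - v j)%N.
    rewrite -(@Gauss_dvdl _ _ (tnth a j %/ gcdn (tnth a i) (tnth a j))); last first.
      rewrite /coprime -(eqn_pmul2r g0) muln_gcdl.
      by rewrite !divnK ?dvdn_gcdl ?dvdn_gcdr // mul1n.
    rewrite -(dvdn_pmul2r g0) -mulnA !divnK ?dvdn_gcdl ?dvdn_gcdr // mulnBl -dv.
    by rewrite addnK dvdn_mull.
  by move/(dvdn_leq pos); lia.
have vjn : v j = n by lia.
move: dv; rewrite vjn -{2}[(n * _)%N]add0n => /addIn/eqP.
rewrite muln_eq0 (gtn_eqF (a_gt0 i)) orbF => /eqP vi.
by rewrite (elimination_order_pure v0 ij) vi vjn mulm0n add0m.
Qed.

Lemma circuit_minimal_nonstandard : minimal_nonstandard a le (circuit_power i j).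
Proof.
apply/andP; split.
  apply: (nonstandard_intro a_gt0 le_mo (v := circuit_power j i)).
  - exact: circuit_power_degreeC.
  - apply/eqP => /mnmP/(_ j); rewrite [LHS]mulmn_neq // => c0.
    by have := circuit_exponent_gt0 i j; rewrite -c0.
  rewrite /elimination_order /refine_order.
  rewrite elimination_weight_fst elimination_weight_snd.
  have -> : circuit_power j i j = 0%N by exact: mulmn_neq.
  by rewrite circuit_exponent_gt0.
apply/forallP => k; apply/implyP; have [->|kj] := eqVneq k j; last first.
  by rewrite mulmn_neq // eq_sym.
move=> pos; rewrite (_ : _ - _ = U_(j) *+ (circuit_power i j j).-1)%MM.
  by apply: standard_power_j; rewrite prednK.
apply/mnmP => l; rewrite mnmBE mnm1E; have [<-|jl] := eqVneq j l.
  by rewrite mulmn_same subn1.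
by rewrite !mulmn_neq.
Qed.

Lemma circuit_normal_form :
  normal_form a le (circuit_power i j) = circuit_power j i.
Proof.
rewrite [RHS]/circuit_power.
have /eqP <- := standard_power_i (tnth a j %/ gcdn (tnth a j) (tnth a i)).
by apply: normal_form_eq => //; rewrite -circuit_power_degreeC.
Qed.

(** Every circuit belongs to the reduced basis for an order that eliminates the
    variables outside of its support. *)
Lemma circuit_universal : universal_groebner_basis I (circuit i j).
Proof.
rewrite /circuit -circuit_normal_form.
exact: (universal_minimal_nonstandard K a_gt0 le_mo elimination_least
  circuit_minimal_nonstandard).
Qed.

End EliminationOrder.

(** * Three variables: a redundant circuit *)

(** If the component of [g] in the degree of its leading exponent were not all of
    [g], the difference would be a nonzero element of the ideal supported on the
    tail of [g], whose monomials are standard. *)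
Lemma universal_homogeneous g :
  universal_groebner_basis I g -> exists d, homogeneous a d g.
Proof.
move=> [le [G [le_mo red gG]]]; have [[GI _] lead _] := red.
have [u lu _] := lead g gG; exists (deg u) => w wg.
have std v : v \in msupp (g - component a (deg u) g) ->
    v \in msupp g /\ deg v <> deg u.
  rewrite !mcoeff_msupp mcoeffB mcoeff_component.
  by case: (deg v =P deg u) => [_|?]; rewrite ?subrr ?eqxx // subr0.
have g0 : g - component a (deg u) g = 0.
  apply: (standard_support_eq0 le_mo (I := I)) => [|v /std[vg dv]].
    exact/(ideal_generatedB (GI g gG))/component_toric_ideal/GI.
  apply: (reduced_tail_standard le_mo red gG lu vg).
  by apply/eqP => vu; apply: dv; rewrite vu.
have /(congr1 (mcoeff w)) := g0; rewrite mcoeffB mcoeff_component mcoeff0.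
case: (deg w =P deg u) => // _ /eqP; rewrite subr0.
by rewrite mcoeff_msupp in wg; rewrite (negbTE wg).
Qed.

(** Binomials of [I] of degree less than the degree of [f] only need generators
    other than [f]. *)
Lemma lower_degree_binomial B f d u v :
    minimal_ideal_generators B I -> (forall b, B b -> exists c, homogeneous a c b) ->
    f != 0 -> homogeneous a d f -> deg u = deg v -> (deg u < d)%N ->
  ideal_generated (fun g => B g /\ g <> f) ('X_[u] - 'X_[v]).
Proof.
move=> [genB _] homB f0 fd uv ud.
have /genB/(component_ideal_generated (deg u) homB) := toric_ideal_binomial K uv.
rewrite (component_homogeneous _ (homogeneous_binomial uv)) eqxx.
apply: ideal_generated_trans => b [Bb [c cu bc]].
apply: ideal_generated_gen; split=> // bf.
move: f0; rewrite -msupp_eq0; case E: (msupp f) => [//|x s] _.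
have xf : x \in msupp f by rewrite E mem_head.
have := fd x xf; rewrite -(bc x) in cu; last by rewrite bf.
by move=> dx; rewrite dx leqNgt ud in cu.
Qed.

(** Splitting off x_k: if the lcm of a_j and a_k is at most that of a_i and a_j,
    the pure power of x_j in the circuit of i and j is congruent, modulo the circuit
    of j and k, to a multiple of x_k. *)
Lemma circuit_power_split i j k :
    (lcmn (tnth a k) (tnth a j) <= lcmn (tnth a i) (tnth a j))%N ->
  exists2 u, deg (U_(k) + u)%MM = deg (circuit_power i j)
    & forall J : {mpoly K[m]} -> Prop, ideal_generated J (circuit k j) ->
      ideal_generated J ('X_[circuit_power i j] - 'X_[U_(k) + u]).
Proof.
rewrite -!circuit_power_degree => le_lcm.
have le_pow : (circuit_power k j <= circuit_power i j)%MM.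
  apply/mnm_lepP => l; have [->|lj] := eqVneq l j; last first.
    by rewrite !mulmn_neq // eq_sym.
  by move: le_lcm; rewrite !semigroup_degree_Mn leq_pmul2r // !mulmn_same.
have Uk := mnm1_lepm (circuit_exponent_gt0 j k).
pose t := (circuit_power i j - circuit_power k j)%MM.
pose u := (circuit_power j k - U_(k) + t)%MM.
have Eu : (U_(k) + u = circuit_power j k + t)%MM.
  by rewrite /u addmA [(U_(k) + _)%MM]addmC submK.
exists u => [|J Jc].
  rewrite Eu semigroup_degreeD circuit_power_degreeC -semigroup_degreeD.
  by rewrite addmC submK.
rewrite Eu -{1}(submK le_pow) addmC !mpolyXD -mulrBl mulrC.
exact: ideal_generatedM.
Qed.

Lemma circuit_neq i j k l :
  i != j -> j != k -> j != l -> circuit i j <> circuit k l.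
Proof.
move=> ij jk jl /(congr1 (mcoeff (circuit_power i j))).
have pos := circuit_exponent_gt0 i j.
have ne i' j' : j != j' -> (circuit_power i' j' == circuit_power i j) = false.
  move=> jj'; apply/eqP => /mnmP/(_ j) E.
  by rewrite -E mulmn_neq // eq_sym in pos.
rewrite /circuit !mcoeffB !mcoeffX eqxx !ne // 1?eq_sym // !subr0.
by move/eqP; rewrite oner_eq0.
Qed.

(** The circuit of largest degree among those of three variables is redundant:
    modulo the other two, both of its monomials are multiples of the third
    variable, and dividing by this variable leaves a binomial of lower degree. *)
Lemma not_robust_triangle i j k :
    i != j -> i != k -> j != k ->
    (lcmn (tnth a k) (tnth a i) <= lcmn (tnth a i) (tnth a j))%N ->
    (lcmn (tnth a k) (tnth a j) <= lcmn (tnth a i) (tnth a j))%N ->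
  ~ robust I.
Proof.
move=> ij ik jk ki kj [B [BU UB _] minB].
have homB b : B b -> exists c, homogeneous a c b.
  by move=> /BU; apply: universal_homogeneous.
suff redundant f : B f -> f = circuit i j \/ f = circuit j i -> False.
  have [Bf|Bf] := UB _ (circuit_universal ij).
    by apply: redundant Bf _; left.
  by apply: redundant Bf _; right; rewrite circuitN.
move=> Bf fE; apply: (minimal_generator_irredundant minB Bf).
set J := fun g => _.
(* the other circuits lack one of the variables x_i, x_j *)
have f_neq p q : (j != p) && (j != q) || (i != p) && (i != q) -> f <> circuit p q.
  have ji : j != i by rewrite eq_sym.
  by case: fE => -> /orP[] /andP[np nq]; first [exact: circuit_neq
    | rewrite -circuitN -[circuit p q]circuitN => /oppr_inj; exact: circuit_neq].
have Jcircuit p q : p != q -> (j != p) && (j != q) || (i != p) && (i != q) ->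
    ideal_generated J (circuit p q).
  move=> pq off; have [B1|B1] := UB _ (circuit_universal pq).
    by apply: ideal_generated_gen; split=> // /esym; apply: f_neq.
  rewrite circuitN in B1; rewrite -circuitN.
  apply/ideal_generatedN/ideal_generated_gen; split=> // /esym; apply: f_neq.
  by rewrite andbC [(i != q) && _]andbC.
have Jki : ideal_generated J (circuit k i).
  by apply: Jcircuit; [rewrite eq_sym | rewrite jk (eq_sym j i) ij].
have Jkj : ideal_generated J (circuit k j).
  by apply: Jcircuit; [rewrite eq_sym | rewrite ik ij orbT].
have [u du Ju] := circuit_power_split kj.
have [|v dv Jv] := @circuit_power_split j i k; first by rewrite [leqRHS]lcmnC.
have Juv : ideal_generated J (circuit i j).
  rewrite /circuit.
  have -> : 'X_[circuit_power i j] - 'X_[circuit_power j i] =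
    ('X_[circuit_power i j] - 'X_[U_(k) + u]) -
    ('X_[circuit_power j i] - 'X_[U_(k) + v]) +
    'X_[U_(k)] * ('X_[u] - 'X_[v]) :> {mpoly K[m]}.
    by rewrite mulrBr -!mpolyXD; ring.
  apply: ideal_generatedD.
    by apply: ideal_generatedB; [apply: Ju|apply: Jv].
  apply: ideal_generatedM.
  apply: (lower_degree_binomial minB homB (d := deg (circuit_power i j))).
  - by apply/eqP => f0; apply: (f_neq k k); rewrite ?ik ?jk // f0 /circuit subrr.
  - by case: fE => ->; [|rewrite -circuit_power_degreeC];
      apply: homogeneous_binomial; rewrite circuit_power_degreeC.
  - by move: du dv; rewrite circuit_power_degreeC !semigroup_degreeD => <- /addnI.
  - rewrite -du semigroup_degreeD -[U_(k)%MM]mulm1n semigroup_degree_Mn mul1n.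
    by have := a_gt0 k; lia.
by case: fE => ->; rewrite // -circuitN; apply: ideal_generatedN.
Qed.
End Circuits.

(** * Two variables: a principal ideal *)

Section TwoGenerators.
Variables (K : fieldType) (m : nat) (a : m.-tuple nat).
Hypothesis a_gt0 : forall i, (0 < tnth a i)%N.
Implicit Types (f g h : {mpoly K[m]}) (u v w : 'X_{1..m}).

Local Notation deg := (semigroup_degree a).
Local Notation I := (toric_ideal K a).

(** The solutions of a linear equation in two unknowns form an arithmetic
    progression, whose step is the exponent vector of the circuit. *)
Lemma two_variable_fiber (i j : 'I_m) u v :
    i != j -> (forall k, k = i \/ k = j) -> deg u = deg v -> (v j <= u j)%N ->
  exists c n, u = (c + circuit_power a i j *+ n)%MM /\
              v = (c + circuit_power a j i *+ n)%MM.
Proof.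
move=> ij two uv vuj; have ji : j != i by rewrite eq_sym.
have degE w : deg w = (w i * tnth a i + w j * tnth a j)%N.
  rewrite /semigroup_degree (bigD1 i) //= (bigD1 j) //= big1 ?addn0 // => k.
  by case/andP; case: (two k) => ->; rewrite eqxx.
move: uv; rewrite !degE => uv.
set g := gcdn (tnth a i) (tnth a j).
have g0 : (0 < g)%N by rewrite gcdn_gt0 a_gt0.
pose p := (tnth a i %/ g)%N; pose q := (tnth a j %/ g)%N.
have Ep : tnth a i = (p * g)%N by rewrite divnK ?dvdn_gcdl.
have Eq : tnth a j = (q * g)%N by rewrite divnK ?dvdn_gcdr.
have p0 : (0 < p)%N by have := a_gt0 i; rewrite Ep; case: (p).
have cop : coprime p q.
  by rewrite /coprime -(eqn_pmul2r g0) muln_gcdl -Ep -Eq mul1n.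
have E1 : ((u j - v j) * q = (v i - u i) * p)%N.
  apply/eqP; rewrite -(eqn_pmul2r g0) -!mulnA -Ep -Eq !mulnBl; apply/eqP; lia.
have vui : (u i <= v i)%N.
  rewrite -(leq_pmul2r (a_gt0 i)).
  by have := leq_mul2r (tnth a j) (v j) (u j); rewrite vuj orbT; lia.
have /dvdnP[n En] : (p %| u j - v j)%N by rewrite -(Gauss_dvdl _ cop) E1 dvdn_mull.
have En' : (v i - u i = n * q)%N.
  by apply/eqP; rewrite -(eqn_pmul2r p0) -E1 En mulnAC.
exists (U_(i) *+ u i + U_(j) *+ v j)%MM, n; split; apply/mnmP => k.
  rewrite !mnmDE (mulmnE (circuit_power a i j)); case: (two k) => ->.
    by rewrite mulmn_same mulmn_neq // circuit_power_off // mul0n !addn0.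
  by rewrite mulmn_same mulmn_neq // circuit_power_same -/g -/p mulnC -En; lia.
rewrite !mnmDE (mulmnE (circuit_power a j i)); case: (two k) => ->.
  rewrite mulmn_same mulmn_neq // circuit_power_same gcdnC -/g -/q mulnC -En'.
  by lia.
by rewrite mulmn_same mulmn_neq // circuit_power_off // mul0n addn0.
Qed.

Variables (i j : 'I_m).
Hypothesis ij : i != j.
Hypothesis two : forall k, k = i \/ k = j.

Lemma toric_ideal_principal f :
  I f <-> ideal_generated (fun g => g = circuit K a i j) f.
Proof.
split; last by apply: ideal_generated_trans => b ->; apply: circuit_in_toric.
apply: ideal_generated_trans => _ [u [v [uv ->]]].
have main u' v' : deg u' = deg v' -> (v' j <= u' j)%N ->
    ideal_generated (fun g => g = circuit K a i j) ('X_[u'] - 'X_[v']).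
  move=> uv' /(two_variable_fiber ij two uv')[c [n [-> ->]]].
  have Xn p : 'X_[p *+ n] = 'X_[p] ^+ n :> {mpoly K[m]} by rewrite mpolyXn.
  rewrite !mpolyXD -mulrBr (Xn (circuit_power a i j)) (Xn (circuit_power a j i)).
  rewrite subrXX mulrCA mulrC.
  by apply: ideal_generatedM; apply: ideal_generated_gen.
have [vu|/ltnW uv'] := leqP (v j) (u j); first exact: main.
by rewrite -opprB; apply/ideal_generatedN/main.
Qed.

Lemma circuit_power_neq : circuit_power a i j != circuit_power a j i.
Proof.
apply/eqP => /mnmP/(_ j); rewrite [RHS]mulmn_neq // => c0.
by have := circuit_exponent_gt0 a_gt0 i j; rewrite c0.
Qed.

Lemma circuit_neq0 : circuit K a i j != 0.
Proof.
apply/eqP => /(congr1 (mcoeff (circuit_power a i j))).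
rewrite mcoeffB !mcoeffX eqxx (eq_sym (circuit_power a j i)).
by rewrite (negbTE circuit_power_neq) subr0 mcoeff0 => /eqP; rewrite oner_eq0.
Qed.

(** Two monomials of one fiber differ by an exchange of powers of the two monomials
    of the circuit; the larger of the two contains the leading one. *)
Lemma nonstandard_circuit_power (le : rel 'X_{1..m}) w :
    monomial_order le -> le (circuit_power a j i) (circuit_power a i j) ->
  ~~ standard a le w -> (circuit_power a i j <= w)%MM.
Proof.
move=> le_mo lji nw; have [_ anti tr _ leD] := le_mo.
have vw := normal_form_le a_gt0 le_mo (erefl (deg w)).
have dv := normal_form_degree a_gt0 le_mo w.
rewrite /standard in nw.
move: (normal_form a le w) nw vw dv => v nvw vw dv.
have [wv|/ltnW vw'] := leqP (v j) (w j).
  have [c [n [Ew Ev]]] := two_variable_fiber ij two (esym dv) wv.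
  case: n Ew Ev => [Ew Ev|n -> _]; first by move: nvw; rewrite Ew Ev eqxx.
  by rewrite mulmS addmA [(c + _)%MM]addmC -addmA lem_addr.
have [c [n [Ev Ew]]] := two_variable_fiber ij two dv vw'.
move/eqP: nvw; case; apply: anti; rewrite vw andbC Ev Ew ![(c + _)%MM]addmC leD //.
elim: n {Ev Ew} => [|n IH]; first exact: monomial_order_refl.
rewrite !mulmS; apply: tr (leD _ _ _ lji) _.
by rewrite ![(circuit_power a i j + _)%MM]addmC leD.
Qed.

(** The leading monomial of the circuit generates the initial ideal, hence is the
    leading monomial of [g]; the difference of the two monic polynomials is then an
    element of the ideal whose monomials are all standard. *)
Lemma reduced_basis_two (le : rel 'X_{1..m}) G g :
    monomial_order le -> le (circuit_power a j i) (circuit_power a i j) ->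
    reduced_groebner_basis le I G -> g \in G ->
  g = circuit K a i j.
Proof.
move=> le_mo lji red gG; have [[GI _] lead _] := red.
have [u lu gu] := lead g gG.
have in_std := toric_initial_idealX K a_gt0 le_mo.
have lc := leading_exponent_binomial K le_mo circuit_power_neq lji.
have nu : ~~ standard a le u.
  by apply/in_std/initial_idealX; exists g, u; split; [exact: GI| |exact: lepm_refl].
have Eu : u = circuit_power a i j.
  apply/esym/(reduced_head_minimal le_mo red gG lu); last first.
    exact: nonstandard_circuit_power nu.
  apply/initial_idealX; exists (circuit K a i j), (circuit_power a i j).
  by split; [exact: circuit_in_toric| |exact: lepm_refl].
apply/eqP; rewrite -subr_eq0; apply/eqP.
apply: (standard_support_eq0 le_mo (I := I)) => [|w].
  by apply/ideal_generatedB; [exact: GI|exact: circuit_in_toric].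
have [->|wu] := eqVneq w u.
  rewrite mcoeff_msupp mcoeffB gu Eu /circuit mcoeffB !mcoeffX eqxx.
  rewrite eq_sym (eq_sym _ (circuit_power a i j)) (negbTE circuit_power_neq).
  by rewrite subr0 subrr eqxx.
move/msuppB_le; rewrite mem_cat => /orP[wg|/msuppB_le].
  exact: (reduced_tail_standard le_mo red gG lu wg).
rewrite mem_cat !msuppX !inE -Eu (negbTE wu) => /eqP-> /in_std nw.
have /mnm_lepP/(_ j) := nonstandard_circuit_power le_mo lji nw.
rewrite [X in (_ <= X)%N]circuit_power_off 1?eq_sym // leqn0 => /eqP c0.
by have := circuit_exponent_gt0 a_gt0 i j; rewrite c0.
Qed.

End TwoGenerators.

Lemma robust_two_generators (K : fieldType) (m : nat) (a : m.-tuple nat) (i j : 'I_m) :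
    (forall k, (0 < tnth a k)%N) -> i != j -> (forall k, k = i \/ k = j) ->
  robust (toric_ideal K a).
Proof.
move=> a_gt0 ij two; have ji : j != i by rewrite eq_sym.
have two' k : k = j \/ k = i by case: (two k); [right|left].
exists (fun g => g = circuit K a i j); split.
- by move=> _ ->; apply: circuit_universal.
- move=> g [le [G [le_mo red gG]]]; have [tot _ _ _ _] := le_mo.
  have [lij|lji] := orP (tot (circuit_power a i j) (circuit_power a j i)).
    by right; rewrite (reduced_basis_two a_gt0 ji two' le_mo lij red gG) circuitN.
  by left; apply: (reduced_basis_two a_gt0 ij two le_mo lji red gG).
- by move=> f -> ->.
- exact: toric_ideal_principal.
move=> C CB genC _ ->.
have [s Cs] := (genC (circuit K a i j)).1 (circuit_in_toric K a i j).
case: s Cs => [|x s] Cs E.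
  by have := circuit_neq0 K a_gt0 ij; rewrite E big_nil eqxx.
have Cx := Cs x (mem_head _ _).
by rewrite -(CB _ Cx).
Qed.

(** * Generators of numerical semigroups *)

Section SemigroupGenerators.
Variables (S : {pred nat}) (m : nat) (a : m.-tuple nat).

(** Zero contributes nothing to sums, so a minimal generating set omits it. *)
Lemma minimal_generators_gt0 :
  minimal_generating_set (mem a) S -> forall i, (0 < tnth a i)%N.
Proof.
move=> [genS minS] i; rewrite lt0n; apply/eqP => ai0.
have a0 : 0%N \in mem a by rewrite -ai0; apply: mem_tnth.
suff genpos : generates_semigroup [pred n | (n \in mem a) && (0 < n)%N] S.
  have sub : {subset [pred n | (n \in mem a) && (0 < n)%N] <= mem a}.
    by move=> n /andP[].
  by have := minS _ sub genpos _ a0; rewrite inE ltnn andbF.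
move=> n; rewrite genS; split=> -[s sA ->]; last first.
  by exists s => // x /sA/andP[].
exists [seq x <- s | (0 < x)%N].
  by move=> x; rewrite mem_filter inE => /andP[-> /sA ->].
by elim: s {sA} => //= x s ->; case: x.
Qed.

(** Beyond all gaps there are two consecutive elements of [S], both divisible by
    [d]. *)
Lemma numerical_semigroup_gcd d :
    numerical_semigroup S -> generates_semigroup (mem a) S ->
    (forall i, (d %| tnth a i)%N) -> d = 1%N.
Proof.
move=> [_ _ [gaps gapsP]] genS da.
have dS n : n \in S -> (d %| n)%N.
  move=> /genS[s sA ->]; elim: s sA => [|x s IH] sA /=; first exact: dvdn0.
  rewrite dvdn_add ?IH // => [|y ys]; last by apply: sA; rewrite inE ys orbT.
  by have /tnthP[k ->] := sA x (mem_head _ _).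
have large n : (sumn gaps < n)%N -> n \in S.
  move=> gn; apply: contraTT gn => /gapsP ng; rewrite -leqNgt.
  elim: gaps ng {gapsP} => //= x s IH; rewrite inE => /orP[/eqP->|/IH]; lia.
have d1 := dS _ (large (sumn gaps).+1 (ltnSn _)).
have := dS _ (large (sumn gaps).+2 (ltnW (ltnSn _))).
by rewrite -addn1 dvdn_addr // dvdn1 => /eqP.
Qed.

Lemma proper_numerical_semigroup_size :
    numerical_semigroup S -> (exists n, n \notin S) ->
  generates_semigroup (mem a) S -> (1 < m)%N.
Proof.
move=> numS [n nS] genS; rewrite ltnNge; apply/negP => m1.
have dvd2 := numerical_semigroup_gcd numS genS.
have [m0|m_gt0] := posnP m.
  by have : 2 = 1%N by apply: dvd2 => k; have := ltn_ord k; lia.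
have ai : tnth a (Ordinal m_gt0) = 1%N.
  apply: dvd2 => k; rewrite (_ : k = Ordinal m_gt0) //.
  by apply: val_inj => /=; have := ltn_ord k; lia.
case/negP: nS; apply/genS; exists (nseq n 1%N); last by rewrite sumn_nseq mul1n.
by move=> x /nseqP[-> _]; rewrite -ai; apply: mem_tnth.
Qed.

End SemigroupGenerators.

(** * Robustness *)

Lemma robust_size (K : fieldType) (m : nat) (a : m.-tuple nat) :
  (forall i, (0 < tnth a i)%N) -> robust (toric_ideal K a) -> (m <= 2)%N.
Proof.
move=> a_gt0 rob; rewrite leqNgt; apply/negP => m3.
pose x := Ordinal (ltnW (ltnW m3)).
pose y := Ordinal (ltnW m3); pose z := Ordinal m3.
have tri i j k := @not_robust_triangle K m a a_gt0 i j k.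
pose l i j := lcmn (tnth a i) (tnth a j).
have lC i j : l i j = l j i by apply: lcmnC.
have [xy|] := boolP ((l z x <= l x y)%N && (l z y <= l x y)%N).
  by case/andP: xy => zx zy; apply: (tri x y z) rob.
have [xz|] := boolP ((l y x <= l x z)%N && (l y z <= l x z)%N).
  by case/andP: xz => yx yz _; apply: (tri x z y) rob.
have := lC x y; have := lC x z; have := lC y z => E1 E2 E3 F1 F2.
by apply: (tri y z x) rob => //;
  [change (l x y <= l y z)%N|change (l x z <= l y z)%N];
  move: (l x y) (l x z) (l y z) (l y x) (l z x) (l z y) E1 E2 E3 F1 F2; lia.
Qed.

Local Close Scope ring_scope.

Theorem corollary4p17 (K : fieldType) (S : {pred nat})
    (hS : numerical_semigroup S) (hproper : exists n : nat, n \notin S)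
    (m : nat) (a : m.-tuple nat) (ha_uniq : uniq a)
    (ha_min : minimal_generating_set (mem a) S) :
  robust (toric_ideal K a) <-> m = 2.
Proof.
have a_gt0 := minimal_generators_gt0 ha_min.
have m2 := proper_numerical_semigroup_size hS hproper ha_min.1.
split=> [/(robust_size a_gt0) m_le2|Em]; first by apply/eqP; rewrite eqn_leq m_le2.
apply: (@robust_two_generators K m a (Ordinal (ltnW m2)) (Ordinal m2)) => // k.
have [k0|k0] := eqVneq (k : nat) 0; [left|right]; apply: val_inj => //=.
by have := ltn_ord k; lia.
Qed.
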